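(* Fix $w>0$ and $\rho\in(-1,1)$. Let $(x_j,y_j)$, $j=1,\dots,k$, be i.i.d. pairs from the bivariate normal distribution with mean $(0,0)$, unit variances and correlation $\rho$. Code each real number $t$ by $c(t)=0$ if $t\le -w$, $c(t)=1$ if $-w<t\le 0$, $c(t)=2$ if $0<t\le w$, $c(t)=3$ if $t>w$. For $i,j\in\{0,1,2,3\}$ let $k_{i,j}$ be the number of indices $j'$ with $(c(x_{j'}),c(y_{j'}))=(i,j)$, let $P_{i,j}(\rho,w)=\Pr(c(x)=i,\,c(y)=j)$ for one such pair $(x,y)$, and let $l(\rho,w)=\sum_{i,j}k_{i,j}\log P_{i,j}(\rho,w)$ be the log-likelihood. Define $P_{2,2}(\rho,w)=\Pr(0<x\le w,\ 0<y\le w)$, $P_{2,3}(\rho,w)=\Pr(x>w,\ 0<y\le w)$, $P_{3,3}(\rho,w)=\Pr(x>w,\ y>w)$, and write $P'_{a,b}(\rho,w)=\frac{\partial}{\partial\rho}P_{a,b}(\rho,w)$ (so $P'_{a,b}(-\rho,w)$ denotes this derivative evaluated at $-\rho$). Then the Fisher information $I_{2,\rho,w}=-E\left[\frac{\partial^2}{\partial\rho^2}l(\rho,w)\right]$ equals $$I_{2,\rho,w}=2k\,A,$$ where $$A=\frac{(P_{2,2}'(\rho,w))^2}{P_{2,2}(\rho,w)}+2\frac{(P_{2,3}'(\rho,w))^2}{P_{2,3}(\rho,w)}+\frac{(P_{3,3}'(\rho,w))^2}{P_{3,3}(\rho,w)}+\frac{(P_{2,2}'(-\rho,w))^2}{P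_{2,2}(-\rho,w)}+2\frac{(P_{2,3}'(-\rho,w))^2}{P_{2,3}(-\rho,w)}+\frac{(P_{3,3}'(-\rho,w))^2}{P_{3,3}(-\rho,w)}.$$
   Context: This is the ''2-bit random projection'' model: $(x,y)$ arise as projections $x=\sum_i u_ir_i$, $y=\sum_i v_ir_i$ of unit-norm vectors $u,v$ with correlation $\rho=\sum_i u_iv_i$ onto i.i.d. $N(0,1)$ entries $r_i$, and each projection is quantized into 2 bits by the thresholds $-w,0,w$. The Fisher information governs the asymptotic variance $1/I_{2,\rho,w}+O(1/k^2)$ of the maximum likelihood estimator of $\rho$ based on the counts $k_{i,j}$. *)

(* Defs.v *)
From HB Require Import structures.
From mathcomp Require Import all_boot all_order all_algebra.
From mathcomp Require Import all_classical all_reals all_analysis.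
Set Implicit Arguments. Unset Strict Implicit. Unset Printing Implicit Defensive.
Import Order.TTheory GRing.Theory Num.Theory.
Import numFieldNormedType.Exports.
Local Open Scope classical_set_scope.
Local Open Scope ring_scope.

Section Defs.
Variable R : realType.

Definition binorm_pdf (rho : R) (z : R * R) : R :=
  (2 * pi * Num.sqrt (1 - rho ^+ 2))^-1 *
  expR (- (z.1 ^+ 2 - 2 * rho * z.1 * z.2 + z.2 ^+ 2) / (2 * (1 - rho ^+ 2))).

Definition code (w t : R) : 'I_4 :=
  if t <= - w then inord 0
  else if t <= 0 then inord 1
  else if t <= w then inord 2
  else inord 3.

Definition Pcell (rho w : R) (ij : 'I_4 * 'I_4) : R :=
  fine (\int[(@lebesgue_measure R) \x (@lebesgue_measure R)]_(z in
          [set z : R * R | code w z.1 = ij.1 /\ code w z.2 = ij.2])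
          (binorm_pdf rho z)%:E)%E.

Definition P22 (rho w : R) : R := Pcell rho w (inord 2, inord 2).
Definition P23 (rho w : R) : R := Pcell rho w (inord 3, inord 2).
Definition P33 (rho w : R) : R := Pcell rho w (inord 3, inord 3).

Definition count_cell (k : nat) (s : {ffun 'I_k -> 'I_4 * 'I_4})
  (ij : 'I_4 * 'I_4) : nat := #|[set m | s m == ij]|.

Definition loglik (k : nat) (s : {ffun 'I_k -> 'I_4 * 'I_4}) (w r : R) : R :=
  \sum_(ij : 'I_4 * 'I_4) (count_cell s ij)%:R * ln (Pcell r w ij).

(* Fisher information -E[d^2 l / d rho^2], the expectation being taken over
   the i.i.d. coded sample (each pair falls in cell ij w.p. P_{ij}(rho,w)) *)
Definition fisher_info (k : nat) (rho w : R) : R :=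
  - \sum_(s : {ffun 'I_k -> 'I_4 * 'I_4})
      (\prod_(m < k) Pcell rho w (s m)) *
      derive1n 2 (fun r => loglik s w r) rho.

Definition dP (P : R -> R -> R) (rho w : R) : R :=
  derive1 (fun r => P r w) rho.

Definition A_term (rho w : R) : R :=
  (dP P22 rho w) ^+ 2 / P22 rho w + 2 * ((dP P23 rho w) ^+ 2 / P23 rho w)
  + (dP P33 rho w) ^+ 2 / P33 rho w
  + (dP P22 (- rho) w) ^+ 2 / P22 (- rho) w
  + 2 * ((dP P23 (- rho) w) ^+ 2 / P23 (- rho) w)
  + (dP P33 (- rho) w) ^+ 2 / P33 (- rho) w.

End Defs.

(* Main.v *)
Require Import Defs.
From mathcomp Require Import all_boot all_order all_algebra.
From mathcomp Require Import all_classical all_reals all_analysis.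
From mathcomp Require Import measurable_realfun ring lra.
Import Order.TTheory GRing.Theory Num.Theory.
Import numFieldNormedType.Exports.
Local Open Scope classical_set_scope.
Local Open Scope ring_scope.
Set Implicit Arguments. Unset Strict Implicit. Unset Printing Implicit Defensive.

(** The counts are multinomial, so with [P] the cell probabilities the
    expectation of [- d^2 l / d rho^2] is [k * \sum (P'^2 / P - P'')], and
    [\sum P'' = 0] because the cell probabilities sum to 1 for every [rho].
    The sixteen terms [P'^2 / P] then collapse to [2 A] by the symmetries
    [(x, y) -> (y, x)], which preserves the density, and [(x, y) -> (-x, y)],
    which changes [rho] into [- rho].

    Analytically, the density is twice differentiable in [rho] under the
    integral sign: for [`|rho| <= a < 1] one has
    [pdf <= C_a * exp (- (x^2 + y^2) / 4)], and the first two derivatives in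
    [rho] are the density times a polynomial of degree at most 4 in [x, y]
    with bounded coefficients, so that a multiple of
    [exp (- (x^2 + y^2) / 8)] dominates everything. *)

(** * The density and its derivatives in the correlation *)

Section Density.
Variable R : realType.
Implicit Types (r a : R) (z : R * R).

(* [score_num r z / (1 - r ^+ 2) ^+ 2] is the derivative of [ln (binorm_pdf r z)]
   in [r]. *)
Definition score_num r z : R :=
  r - r ^+ 3 + z.1 * z.2 * (1 + r ^+ 2) - (z.1 ^+ 2 + z.2 ^+ 2) * r.

Definition binorm_pdf1 r z : R :=
  score_num r z / (1 - r ^+ 2) ^+ 2 * binorm_pdf r z.

(** The product rule applied to [binorm_pdf1], put over one denominator so that
    [rational_binorm_pdf_le] applies with exponent 4. The last summand of the numerator carries the
    derivative of [score_num]. *)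
Definition binorm_pdf2 r z : R :=
  (score_num r z ^+ 2 + 4 * r * (1 - r ^+ 2) * score_num r z
   + (1 - 3 * r ^+ 2 + 2 * r * (z.1 * z.2) - (z.1 ^+ 2 + z.2 ^+ 2))
     * (1 - r ^+ 2) ^+ 2) / (1 - r ^+ 2) ^+ 4 * binorm_pdf r z.

Lemma subr_sqr_gt0 r : -1 < r < 1 -> 0 < 1 - r ^+ 2.
Proof. by move=> /andP[r1 r2]; nra. Qed.

Lemma is_derive_1Bsqr r : is_derive r 1 (fun r : R => 1 - r ^+ 2) (- (2 * r)).
Proof.
have h : is_derive r 1 (cst 1 - (@id R) ^+ 2) (0 - (2%:R * id r ^+ 1) *: 1).
  by apply: is_deriveB.
by apply: is_derive_eq h _; rewrite scaler1 sub0r expr1.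
Qed.

Lemma is_derive_binorm_pdf r z : -1 < r < 1 ->
  is_derive r 1 (fun r => binorm_pdf r z) (binorm_pdf1 r z).
Proof.
move=> r1; have u0 := subr_sqr_gt0 r1.
pose U : R -> R := fun r : R => 1 - r ^+ 2.
have dU : is_derive r 1 U (- (2 * r)) by exact: is_derive_1Bsqr.
have ds : is_derive r 1 (Num.sqrt \o U) _ :=
  @is_derive1_comp R Num.sqrt U r _ _ (is_derive1_sqrt u0) dU.
have s0 : (Num.sqrt \o U) r != 0 by rewrite gt_eqF// sqrtr_gt0.
have dsV := is_deriveV s0 ds.
have dUV := is_deriveV (lt0r_neq0 u0 : U r != 0) dU.
(* The exponent is split as [q / U], where [q] is affine in the correlation. *)
pose q := fun r : R => - (z.1 ^+ 2 - 2 * r * z.1 * z.2 + z.2 ^+ 2) / 2.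
have dq : is_derive r 1 q (z.1 * z.2).
  have h : is_derive r 1
    (cst (- (z.1 ^+ 2 + z.2 ^+ 2) / 2) + (z.1 * z.2) *: (@id R))
    (0 + (z.1 * z.2) *: 1) by apply: is_deriveD.
  rewrite (_ : q = cst (- (z.1 ^+ 2 + z.2 ^+ 2) / 2) + (z.1 * z.2) *: (@id R)).
    by apply: is_derive_eq h _; rewrite scaler1 add0r.
  by apply/funext => t /=; rewrite /q !fctE /= /GRing.scale/=; field.
have de := @is_derive1_comp R expR (q * (fun y => (U y)^-1)) r _ _
  (is_derive_expR _) (is_deriveM dq dUV).
have dd := is_deriveZ ((2 * pi)^-1 : R) (is_deriveM dsV de).
rewrite (_ : (fun _ => _) = ((2 * pi)^-1 : R) *:
    ((fun y => ((Num.sqrt \o U) y)^-1) * (expR \o (q * (fun y => (U y)^-1))))).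
  apply: is_derive_eq dd _.
  rewrite /binorm_pdf1 /binorm_pdf /= !fctE /= /q.
  rewrite (_ : - (z.1 ^+ 2 - 2 * r * z.1 * z.2 + z.2 ^+ 2) / 2 * (U r)^-1 =
     - (z.1 ^+ 2 - 2 * r * z.1 * z.2 + z.2 ^+ 2) / (2 * (1 - r ^+ 2))); last first.
    by rewrite invfM mulrA.
  set e := expR _.
  rewrite /GRing.scale/= /score_num.
  have V0 : 1 - r ^+ 2 != 0 by rewrite gt_eqF.
  have pi0 : (pi : R) != 0 by rewrite gt_eqF// pi_gt0.
  have s0' : Num.sqrt (1 - r ^+ 2) != 0 by [].
  (* With the square of the root eliminated, the root and [pi] can be generalised to nonzero
     unknowns, and a rational identity remains. *)
  rewrite /U (sqr_sqrtr (ltW u0)).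
  move: (Num.sqrt _) (pi : R) s0' pi0 => S c S0 c0.
  by field; rewrite S0 c0 V0.
apply/funext => t; rewrite /binorm_pdf !fctE /= /q /GRing.scale/= -/(U t).
by rewrite !invfM !mulrA.
Qed.

Lemma is_derive_binorm_pdf1 r z : -1 < r < 1 ->
  is_derive r 1 (fun r => binorm_pdf1 r z) (binorm_pdf2 r z).
Proof.
move=> r1; have u0 := subr_sqr_gt0 r1.
pose U2 : R -> R := fun r : R => (1 - r ^+ 2) ^+ 2.
have dU2 : is_derive r 1 U2 _ := is_deriveX 2 (is_derive_1Bsqr r).
have U20 : U2 r != 0 by rewrite /U2 expf_neq0// gt_eqF.
have dUV := is_deriveV U20 dU2.
pose p := z.1 * z.2; pose s := z.1 ^+ 2 + z.2 ^+ 2.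
pose q : R -> R := fun r => score_num r z.
have dq : is_derive r 1 q (1 - 3 * r ^+ 2 + 2 * r * p - s).
  have d1 := is_derive_id r (1 : R).
  have h1 := is_deriveB d1 (is_deriveX 3 d1).
  have h2 := is_deriveZ p (is_deriveD (is_derive_cst (1 : R) r 1) (is_deriveX 2 d1)).
  have h := is_deriveB (is_deriveD h1 h2) (is_deriveZ s d1).
  apply: is_derive_eq h _.
  by rewrite /GRing.scale/= expr1; ring.
have dd := is_deriveM (is_deriveM dq dUV) (is_derive_binorm_pdf z r1).
apply: is_derive_eq dd _.
have V0 : 1 - r ^+ 2 != 0 by rewrite gt_eqF.
rewrite /binorm_pdf1 /binorm_pdf2 !fctE /= /q /U2 /GRing.scale/= /p /s.
by rewrite /score_num; field.
Qed.

Lemma measurable_binorm_pdf r : measurable_fun setT (binorm_pdf r).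
Proof.
apply: measurable_funM => //; apply: measurableT_comp => //.
apply: measurable_funM => //; apply: measurableT_comp => //.
apply: measurable_funD; last by apply: measurable_funX; exact: measurable_snd.
apply: measurable_funB; first by apply: measurable_funX; exact: measurable_fst.
apply: measurable_funM; last exact: measurable_snd.
by apply: measurable_funM => //; exact: measurable_fst.
Qed.

Lemma measurable_score_num r : measurable_fun setT (score_num r).
Proof.
apply: measurable_funB; last first.
  by apply: measurable_funM => //; apply: measurable_funD;
    apply: measurable_funX; [exact: measurable_fst|exact: measurable_snd].
apply: measurable_funD => //; apply: measurable_funM => //.
by apply: measurable_funM; [exact: measurable_fst|exact: measurable_snd].
Qed.

Lemma measurable_binorm_pdf1 r : measurable_fun setT (binorm_pdf1 r).
Proof.
apply: measurable_funM; last exact: measurable_binorm_pdf.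
by apply: measurable_funM => //; exact: measurable_score_num.
Qed.

Lemma binorm_pdf_gt0 r z : -1 < r < 1 -> 0 < binorm_pdf r z.
Proof.
move=> /subr_sqr_gt0 u0; rewrite mulr_gt0 ?expR_gt0// invr_gt0.
by rewrite !mulr_gt0 ?pi_gt0// sqrtr_gt0.
Qed.

End Density.

(** * Domination by a Gaussian *)

Section Domination.
Variable R : realType.
Implicit Types (r a : R) (z : R * R).

(** Standard deviation 2 gives the exponent [- (x^2 + y^2) / 8]; writing it with normal densities
    makes integrability immediate. *)
Definition gauss_majorant z : R := normal_pdf 0 2 z.1 * normal_pdf 0 2 z.2.

Lemma gauss_majorant_ge0 z : 0 <= gauss_majorant z.
Proof. by rewrite mulr_ge0// normal_pdf_ge0. Qed.

Lemma gauss_majorantE z :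
  gauss_majorant z = normal_peak 2 ^+ 2 * expR (- (z.1 ^+ 2 + z.2 ^+ 2) / 8).
Proof.
rewrite /gauss_majorant normal_pdfE// /normal_fun !subr0.
rewrite mulrACA -expRD; congr (_ * expR _).
by field.
Qed.

(** The normalising constant grows with [|r|]. The quadratic form in the exponent has least
    eigenvalue [1 / (2 * (1 + |r|))], which is at least 1/4. *)
Lemma binorm_pdf_le a r z : a < 1 -> `|r| <= a ->
  binorm_pdf r z <=
  (2 * pi * Num.sqrt (1 - a ^+ 2))^-1 * expR (- (z.1 ^+ 2 + z.2 ^+ 2) / 4).
Proof.
move=> a1 ra; have a0 : 0 <= a by exact: le_trans ra.
have da : 0 < 1 - a ^+ 2 by nra.
have ra2 : r ^+ 2 <= a ^+ 2 by rewrite -[r ^+ 2]real_normK ?num_real// lerXn2r ?nnegrE.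
have dr : 0 < 1 - r ^+ 2 by lra.
have piS b : 0 < 1 - b ^+ 2 -> 0 < 2 * pi * Num.sqrt (1 - b ^+ 2) :> R.
  by move=> b0; rewrite !mulr_gt0 ?pi_gt0// sqrtr_gt0.
rewrite /binorm_pdf ler_pM ?expR_ge0 ?invr_ge0//.
    by rewrite ltW ?piS.
  rewrite lef_pV2 ?posrE ?piS// ler_wpM2l//.
    by rewrite mulr_ge0// pi_ge0.
  by rewrite ler_wsqrtr//; lra.
rewrite ler_expR !mulNr lerN2 ler_pdivlMr; last by rewrite mulr_gt0.
(* [(1 + r^2) (x^2 + y^2) - 4 r x y = (x - r y)^2 + (y - r x)^2] *)
have := sqr_ge0 (z.1 - r * z.2); have := sqr_ge0 (z.2 - r * z.1).
move: dr; clear; nra.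
Qed.

(* Absorbs the polynomial factors at the price of weakening
   [exp (- s / 4)] to [exp (- s / 8)]. *)
Lemma sqr_1D_le_expR (s : R) : 0 <= s -> (1 + s) ^+ 2 <= 256 * expR (s / 8).
Proof.
(* The constant is [256 = 16 ^+ 2]: square [exp (s / 16) >= 1 + s / 16 >= (1 + s) / 16]. *)
move=> s0; have h := expR_ge1Dx (s / 16).
have -> : s / 8 = s / 16 + s / 16 by field.
by rewrite expRD; nra.
Qed.

(** One bound for the density ([n = 0]) and its first two derivatives ([n = 2] and [n = 4]), uniform
    in [r] and [z]. The constant 14 is the one required by the second derivative. *)
Lemma rational_binorm_pdf_le (n : nat) a : 0 <= a < 1 ->
  exists M, forall (c : R) r z, `|r| <= a ->
    `|c| <= 14 * (1 + (z.1 ^+ 2 + z.2 ^+ 2)) ^+ 2 ->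
    `|c / (1 - r ^+ 2) ^+ n * binorm_pdf r z| <= M * gauss_majorant z.
Proof.
move=> /andP[a0 a1].
pose C := (2 * pi * Num.sqrt (1 - a ^+ 2))^-1 : R.
have C0 : 0 <= C by rewrite invr_ge0 !mulr_ge0 ?pi_ge0 ?sqrtr_ge0.
have da : 0 < 1 - a ^+ 2 by nra.
exists (14 * 256 * (1 - a ^+ 2) ^- n * C / normal_peak 2 ^+ 2) => c r z ra cS.
have ra2 : r ^+ 2 <= a ^+ 2 by rewrite -[r ^+ 2]real_normK ?num_real// lerXn2r ?nnegrE.
have dr : 0 < 1 - r ^+ 2 by lra.
have r1 : -1 < r < 1 by rewrite -ltr_norml (le_lt_trans ra).
have s0 : 0 <= z.1 ^+ 2 + z.2 ^+ 2 by rewrite addr_ge0// sqr_ge0.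
rewrite gauss_majorantE [leRHS]mulrA divfK; last first.
  by rewrite expf_neq0// gt_eqF// normal_peak_gt0.
rewrite normrM (ger0_norm (ltW (binorm_pdf_gt0 z r1))) normrM normfV normrX.
rewrite (ger0_norm (ltW dr)).
have hu : (1 - r ^+ 2) ^- n <= (1 - a ^+ 2) ^- n.
  by rewrite lef_pV2 ?posrE ?exprn_gt0// lerXn2r ?nnegrE ?(ltW dr) ?(ltW da)//; lra.
have hS := le_trans cS (ler_wpM2l (ler0n _ _) (sqr_1D_le_expR s0)).
(* The factor with exponent [s / 8] pays for the polynomial, the one with [- s / 4] for the
   density. *)
have -> : - (z.1 ^+ 2 + z.2 ^+ 2) / 8 =
  (z.1 ^+ 2 + z.2 ^+ 2) / 8 + - (z.1 ^+ 2 + z.2 ^+ 2) / 4 by field.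
rewrite expRD.
have hphi := binorm_pdf_le z a1 ra; rewrite -/C in hphi.
have h1 : 0 <= (1 - r ^+ 2) ^- n by rewrite invr_ge0 exprn_ge0// ltW.
have h2 := ltW (binorm_pdf_gt0 z r1).
have h3 := mulr_ge0 (normr_ge0 c) h1.
apply: le_trans (ler_pM h3 h2 (ler_pM (normr_ge0 c) h1 hS hu) hphi) _.
by rewrite le_eqVlt; apply/orP; left; apply/eqP; ring.
Qed.

Lemma score_num_le r z : `|r| <= 1 ->
  `|score_num r z| <= 2 * (1 + (z.1 ^+ 2 + z.2 ^+ 2)).
Proof.
rewrite ler_norml => /andP[r0 r1]; rewrite ler_norml /score_num.
have xy1 := sqr_ge0 (z.1 - z.2); have xy2 := sqr_ge0 (z.1 + z.2).
set p := z.1 * z.2; set s := z.1 ^+ 2 + z.2 ^+ 2.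
have ps : p <= s / 2 by rewrite /p /s; move: xy1; clear; nra.
have ps' : - (s / 2) <= p by rewrite /p /s; move: xy2; clear; nra.
have r2 : 0 <= r ^+ 2 <= 1 by apply/andP; split; nra.
have [r20 r21] := andP r2.
have r3 : -1 <= r - r ^+ 3 <= 1.
  by rewrite (_ : r - r ^+ 3 = r * (1 - r ^+ 2)); [apply/andP; split; nra|ring].
have [r30 r31] := andP r3.
have s0 : 0 <= s by lra.
apply/andP; split; nra.
Qed.

Lemma binorm_pdf2_num_le r z : `|r| <= 1 ->
  `|score_num r z ^+ 2 + 4 * r * (1 - r ^+ 2) * score_num r z
   + (1 - 3 * r ^+ 2 + 2 * r * (z.1 * z.2) - (z.1 ^+ 2 + z.2 ^+ 2))
     * (1 - r ^+ 2) ^+ 2| <= 14 * (1 + (z.1 ^+ 2 + z.2 ^+ 2)) ^+ 2.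
Proof.
move=> r1; have := score_num_le z r1; move: (score_num r z) => q.
have xy1 := sqr_ge0 (z.1 - z.2); have xy2 := sqr_ge0 (z.1 + z.2).
set p := z.1 * z.2; set s := z.1 ^+ 2 + z.2 ^+ 2.
have ps : `|p| <= s / 2.
  by rewrite ler_norml /p /s; move: xy1 xy2; clear => *; apply/andP; split; nra.
have s0 : 0 <= s by rewrite addr_ge0// sqr_ge0.
clearbody p s; clear xy1 xy2.
have r20 := sqr_ge0 r.
have r21 : r ^+ 2 <= 1 by rewrite -[r ^+ 2]real_normK ?num_real// exprn_ile1.
move=> qs.
have u1 : `|1 - r ^+ 2| <= 1 by rewrite ler_norml; apply/andP; split; lra.
have h1 : `|q ^+ 2| <= 4 * (1 + s) ^+ 2.
  by rewrite normrX (_ : 4 * _ = (2 * (1 + s)) ^+ 2); [rewrite lerXn2r ?nnegrE//; lra|ring].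
have h2 : `|4 * r * (1 - r ^+ 2) * q| <= 8 * (1 + s).
  rewrite (_ : 8 * (1 + s) = 4 * 1 * 1 * (2 * (1 + s))); last by ring.
  by rewrite !normrM !ler_pM ?mulr_ge0 ?normr_nat.
have h3 : `|(1 - 3 * r ^+ 2 + 2 * r * p - s) * (1 - r ^+ 2) ^+ 2| <=
    2 * (1 + s).
  rewrite -[leRHS]mulr1 normrM ler_pM//; last by rewrite normrX exprn_ile1.
  have : `|2 * r * p| <= s.
    rewrite !normrM (_ : s = 2 * 1 * (s / 2)); last by field.
    by rewrite !ler_pM ?mulr_ge0 ?normr_nat.
  rewrite !ler_norml => /andP[A B]; apply/andP; split; lra.
apply: le_trans (ler_normD _ _) _; apply: le_trans (lerD (ler_normD _ _) (lexx _)) _.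
(* The three bounds add up to [14 = 4 + 8 + 2], because [1 + s <= (1 + s) ^+ 2]. *)
nra.
Qed.

End Domination.

(** * Differentiation under the integral sign *)

Section Integration.
Variable R : realType.
Implicit Types (r a w : R) (z : R * R).

Local Notation mu := (@lebesgue_measure R).
Local Notation mu2 := (mu \x mu)%E.
Local Notation RR := (measurableTypeR R * measurableTypeR R)%type.

(** Integrating over [y] first meets a normal density of mean [c * x], of mass 1. The case [c = r]
    gives the mass of the bivariate density, the case [c = 0] the integrability of the majorant. *)
Lemma integral_normal_pdf_pair (c s t : R) : t != 0 ->
  (\int[mu2]_z (normal_pdf 0 s z.1 * normal_pdf 0 t (z.2 - c * z.1))%:E = 1)%E.
Proof.
move=> t0.
have m1 : measurable_fun setT (fun z : R * R => normal_pdf 0 s z.1).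
  by apply: measurableT_comp; [exact: measurable_normal_pdf|exact: measurable_fst].
have m2 : measurable_fun setT (fun z : R * R => normal_pdf 0 t (z.2 - c * z.1)).
  apply: measurableT_comp; first exact: measurable_normal_pdf.
  apply: measurable_funB; first exact: measurable_snd.
  by apply: measurable_funM => //; exact: measurable_fst.
rewrite fubini_tonelli1//=; last 2 first.
- by apply/measurable_EFinP; exact: measurable_funM.
- by move=> z; rewrite lee_fin mulr_ge0// normal_pdf_ge0.
rewrite -[RHS](integral_normal_pdf 0 s); apply: eq_integral => x _.
rewrite /fubini_F/=.
under eq_integral => y _.
  rewrite (_ : normal_pdf 0 t (y - c * x) = normal_pdf (c * x) t y); last first.
    by rewrite !normal_pdfE// /normal_fun subr0.
  rewrite EFinM.
  over.
rewrite ge0_integralZl//=.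
- by rewrite integral_normal_pdf mule1.
- by apply/measurable_EFinP; exact: measurable_normal_pdf.
- by move=> y _; rewrite lee_fin normal_pdf_ge0.
- by rewrite lee_fin normal_pdf_ge0.
Qed.

(* Marginal of [x] times the conditional density of [y] given [x]. *)
Lemma binorm_pdf_normalE r z : -1 < r < 1 -> binorm_pdf r z =
  normal_pdf 0 1 z.1 * normal_pdf 0 (Num.sqrt (1 - r ^+ 2)) (z.2 - r * z.1).
Proof.
move=> /subr_sqr_gt0 u0.
have s0 : Num.sqrt (1 - r ^+ 2) != 0 by rewrite gt_eqF// sqrtr_gt0.
rewrite !normal_pdfE ?oner_eq0// /normal_fun /normal_peak !subr0.
rewrite sqr_sqrtr ?(ltW u0)// expr1n mul1r mulrACA -expRD -invfM.
rewrite -sqrtrM ?(mulrn_wge0 2 (pi_ge0 R))// /binorm_pdf.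
congr (_^-1 * expR _).
  rewrite (_ : (pi *+ 2) * (_ *+ 2) = (2 * pi) ^+ 2 * (1 - r ^+ 2)); last by ring.
  by rewrite sqrtrM ?sqr_ge0// sqrtr_sqr ger0_norm// mulr_ge0// pi_ge0.
have V0 : 1 - r ^+ 2 != 0 by rewrite gt_eqF.
by field.
Qed.

Lemma integral_binorm_pdf r : -1 < r < 1 ->
  (\int[mu2]_z (binorm_pdf r z)%:E = 1)%E.
Proof.
move=> r1; rewrite -[RHS](@integral_normal_pdf_pair r 1 (Num.sqrt (1 - r ^+ 2))).
  by apply: eq_integral => z _; rewrite binorm_pdf_normalE.
by rewrite gt_eqF// sqrtr_gt0 subr_sqr_gt0.
Qed.

Lemma integrable_gauss_majorant (M : R) (D : set RR) : measurable D ->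
  mu2.-integrable D (EFin \o (fun z => M * gauss_majorant z)).
Proof.
move=> mD; apply: (@integrableS _ _ _ _ setT) => //.
have -> : EFin \o (fun z => M * gauss_majorant z) =
    (fun z => M%:E * (gauss_majorant z)%:E)%E :> (R * R -> \bar R).
  by apply/funext => z; rewrite /= EFinM.
apply: integrableZl => //; apply/integrableP; split.
  apply/measurable_EFinP; apply: measurable_funM.
    by apply: measurableT_comp; [exact: measurable_normal_pdf|exact: measurable_fst].
  by apply: measurableT_comp; [exact: measurable_normal_pdf|exact: measurable_snd].
have -> : (\int[mu2]_z `|(gauss_majorant z)%:E| =
    \int[mu2]_z (normal_pdf 0 2 z.1 * normal_pdf 0 2 (z.2 - 0 * z.1))%:E)%E.
  apply: eq_integral => z _.
  by rewrite gee0_abs ?lee_fin ?gauss_majorant_ge0// mul0r subr0.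
by rewrite integral_normal_pdf_pair// ltry.
Qed.

(** The majorants are uniform only on [|s| <= a] with [a < 1], so dominated differentiation takes
    place on an interval []-a, a[] around [r]. An abstract [f] lets it serve for both
    derivatives. *)
Lemma is_derive_Rintegral (f f' : R -> RR -> R) (D : set RR) r :
  measurable D -> -1 < r < 1 ->
  (forall s, measurable_fun setT (f s)) ->
  (forall (s : R) z, -1 < s < 1 -> is_derive s 1 (fun s => f s z) (f' s z)) ->
  (forall a, 0 <= a < 1 -> exists M, forall (s : R) z, `|s| <= a ->
     `|f s z| <= M * gauss_majorant z) ->
  (forall a, 0 <= a < 1 -> exists M, forall (s : R) z, `|s| <= a ->
     `|f' s z| <= M * gauss_majorant z) ->
  is_derive r 1 (fun s => \int[mu2]_(z in D) f s z) (\int[mu2]_(z in D) f' r z).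
Proof.
move=> mD r1 mf df bf bf'.
have nr : `|r| < 1 by rewrite ltr_norml.
(* The midpoint of [|r|] and 1. *)
pose a := (1 + `|r|) / 2.
have a01 : 0 <= a < 1 by rewrite /a; have := normr_ge0 r; move=> h; apply/andP; split; lra.
have ra : `](- a), a[%classic r.
  by rewrite /= in_itv/= -ltr_norml /a; lra.
have Ia s : `](- a), a[%classic s -> -1 < s < 1 /\ `|s| <= a.
  rewrite /= in_itv/= -!ltr_norml => sa; split; last exact: ltW.
  by case/andP : a01 => _; exact: lt_trans.
have [M bM] := bf _ a01; have [M' bM'] := bf' _ a01.
have d1E s z : `](- a), a[%classic s -> partial1of2 f s z = f' s z.
  by move=> /Ia[s1 _]; rewrite partial1of2E; apply: (@derive_val _ _ _ _ _ _ _ (df s z s1)).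
have intf s : `](- a), a[%classic s -> mu2.-integrable D (EFin \o f s).
  move=> /Ia[s1 sa]; apply: le_integrable (integrable_gauss_majorant M mD) => //.
    by apply/measurable_EFinP; apply: measurable_funS (mf s).
  by move=> z _ /=; rewrite lee_fin (le_trans (bM _ _ sa))// ler_norm.
have derf s z : `](- a), a[%classic s -> D z -> derivable (f ^~ z) s 1.
  by move=> /Ia[s1 _] _; case: (df s z s1).
(* The sign of [M'] is unknown; its absolute value makes the dominating function nonnegative. *)
have bG s z : `](- a), a[%classic s -> D z ->
    `|partial1of2 f s z| <= `|M'| * gauss_majorant z.
  move=> Is _; rewrite d1E//; have [_ sa] := Ia _ Is.
  by rewrite (le_trans (bM' _ _ sa))// ler_wpM2r ?gauss_majorant_ge0 ?ler_norm.
have G0 z : 0 <= `|M'| * gauss_majorant z by rewrite mulr_ge0 ?gauss_majorant_ge0.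
have iG := integrable_gauss_majorant `|M'| mD.
apply: DeriveDef.
  exact: (derivable_under_integral mD ra intf derf G0 iG bG).
rewrite -derive1E (differentiation_under_integral mD ra intf derf G0 iG bG).
by apply: eq_Rintegral => z _; exact: d1E.
Qed.

(** * Derivatives of the cell probabilities in the correlation *)

Definition Pcell1 r w ij : R :=
  \int[mu2]_(z in [set z | Defs.code w z.1 = ij.1 /\ Defs.code w z.2 = ij.2]) binorm_pdf1 r z.
Definition Pcell2 r w ij : R :=
  \int[mu2]_(z in [set z | Defs.code w z.1 = ij.1 /\ Defs.code w z.2 = ij.2]) binorm_pdf2 r z.

Lemma binorm_pdf1_le a : 0 <= a < 1 -> exists M, forall (s : R) z, `|s| <= a ->
  `|binorm_pdf1 s z| <= M * gauss_majorant z.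
Proof.
move=> a01; have [M bM] := rational_binorm_pdf_le 2 a01.
exists M => s z sa; apply: bM => //.
have s1 : `|s| <= 1 by case/andP: a01 => _ /ltW; exact: le_trans.
apply: le_trans (score_num_le z s1) _.
have : 0 <= z.1 ^+ 2 + z.2 ^+ 2 by rewrite addr_ge0// sqr_ge0.
by move: (_ + _) => t t0; nra.
Qed.

Lemma code_setE w (i : 'I_4) : 0 < w -> [set t | Defs.code w t = i] =
  [set` nth `]-oo, - w] [:: `]-oo, - w]; `](- w), 0]; `]0, w]; `]w, +oo[] i].
Proof.
move=> w0; apply/seteqP; split => [t /= <-|t].
  rewrite /Defs.code; case: (leP t (- w)) => h1; first by rewrite inordK//= in_itv/=.
  case: (leP t 0) => h2; first by rewrite inordK//= in_itv/= h1.
  case: (leP t w) => h3; first by rewrite inordK//= in_itv/= h2.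
  by rewrite inordK//= in_itv/= h3.
case: i => -[|[|[|[|//]]]] /= i4; rewrite in_itv/= /Defs.code.
- by move=> ->; apply/val_inj; rewrite /= inordK.
- by move=> /andP[h1 h2]; rewrite leNgt h1/= h2; apply/val_inj; rewrite /= inordK.
- move=> /andP[h1 h2]; rewrite leNgt (lt_trans _ h1) ?oppr_lt0//= leNgt h1/= h2.
  by apply/val_inj; rewrite /= inordK.
- rewrite andbT => h; rewrite leNgt (lt_trans _ h) ?gtrN//=.
  rewrite leNgt (lt_trans w0 h)/= leNgt h/=.
  by apply/val_inj; rewrite /= inordK.
Qed.

Lemma measurable_code_set w (i : 'I_4) : 0 < w -> measurable [set t | Defs.code w t = i].
Proof. by move=> w0; rewrite code_setE//; exact: measurable_itv. Qed.

Lemma measurable_cell w (ij : 'I_4 * 'I_4) : 0 < w ->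
  measurable [set z : RR | Defs.code w z.1 = ij.1 /\ Defs.code w z.2 = ij.2].
Proof.
move=> w0; apply: (measurableX (A := [set t | Defs.code w t = ij.1])
  (B := [set t | Defs.code w t = ij.2])); exact: measurable_code_set.
Qed.

Lemma is_derive_Pcell r w ij : 0 < w -> -1 < r < 1 ->
  is_derive r 1 (fun s => Pcell s w ij) (Pcell1 r w ij).
Proof.
move=> w0 r1; have mD := @measurable_cell w ij w0.
apply: (@is_derive_Rintegral (@binorm_pdf R) (@binorm_pdf1 R) _ r mD r1).
- exact: measurable_binorm_pdf.
- exact: is_derive_binorm_pdf.
(* The density itself is the case of numerator 1 and exponent 0. *)
- move=> a a01; have [M bM] := rational_binorm_pdf_le 0 a01.
  exists M => s z sa; have := bM 1 s z sa.
  rewrite expr0 divr1 mul1r; apply; rewrite normr1.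
  have : 0 <= z.1 ^+ 2 + z.2 ^+ 2 by rewrite addr_ge0// sqr_ge0.
  by move: (_ + _) => t t0; nra.
- exact: binorm_pdf1_le.
Qed.

Lemma is_derive_Pcell1 r w ij : 0 < w -> -1 < r < 1 ->
  is_derive r 1 (fun s => Pcell1 s w ij) (Pcell2 r w ij).
Proof.
move=> w0 r1; have mD := @measurable_cell w ij w0.
apply: (@is_derive_Rintegral (@binorm_pdf1 R) (@binorm_pdf2 R) _ r mD r1).
- exact: measurable_binorm_pdf1.
- exact: is_derive_binorm_pdf1.
- exact: binorm_pdf1_le.
- move=> a a01; have [M bM] := rational_binorm_pdf_le 4 a01.
  exists M => s z sa; apply: bM => //; apply: binorm_pdf2_num_le.
  by case/andP: a01 => _ /ltW; exact: le_trans.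
Qed.

End Integration.

(** * Cell probabilities *)

Section Cells.
Variable R : realType.
Implicit Types (r a w : R) (z : R * R).

Local Notation mu := (@lebesgue_measure R).
Local Notation mu2 := (mu \x mu)%E.
Local Notation RR := (measurableTypeR R * measurableTypeR R)%type.

Definition cell w (ij : 'I_4 * 'I_4) : set RR :=
  [set z | Defs.code w z.1 = ij.1 /\ Defs.code w z.2 = ij.2].

Lemma integrable_binorm_pdf r (D : set RR) : measurable D -> -1 < r < 1 ->
  mu2.-integrable D (EFin \o binorm_pdf r).
Proof.
move=> mD r1; apply: (@integrableS _ _ _ _ setT) => //.
apply/integrableP; split.
  by apply/measurable_EFinP; exact: measurable_binorm_pdf.
have -> : (\int[mu2]_z `|(EFin \o binorm_pdf r) z| =
    \int[mu2]_z (binorm_pdf r z)%:E)%E.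
  by apply: eq_integral => z _; rewrite gee0_abs// lee_fin ltW// binorm_pdf_gt0.
by rewrite integral_binorm_pdf// ltry.
Qed.

Lemma EFin_Pcell r w ij : 0 < w -> -1 < r < 1 ->
  (Pcell r w ij)%:E = (\int[mu2]_(z in cell w ij) (binorm_pdf r z)%:E)%E.
Proof.
move=> w0 r1; rewrite /Pcell fineK//.
apply: (@integrable_fin_num _ _ _ mu2); first exact: measurable_cell.
by apply: integrable_binorm_pdf => //; exact: measurable_cell.
Qed.

Lemma binorm_pdf_swap r (x y : R) : binorm_pdf r (y, x) = binorm_pdf r (x, y).
Proof.
rewrite /binorm_pdf /fst /snd.
by rewrite (_ : y ^+ 2 - 2 * r * y * x + x ^+ 2 = x ^+ 2 - 2 * r * x * y + y ^+ 2) //; ring.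
Qed.

Lemma binorm_pdf_oppr r (x y : R) :
  binorm_pdf r (- x, y) = binorm_pdf (- r) (x, y).
Proof.
rewrite /binorm_pdf /fst /snd (sqrrN r).
rewrite (_ : (- x) ^+ 2 - 2 * r * (- x) * y + y ^+ 2 =
             x ^+ 2 - 2 * (- r) * x * y + y ^+ 2) //; ring.
Qed.

(** The cells partition the plane, on which the density has mass 1. *)
Lemma sum_Pcell r w : 0 < w -> -1 < r < 1 -> \sum_ij Pcell r w ij = 1.
Proof.
move=> w0 r1; apply: EFin_inj.
rewrite -sumEFin -(integral_binorm_pdf r1).
under eq_bigr do rewrite EFin_Pcell//.
have cellT : \big[setU/set0]_(ij <- index_enum ('I_4 * 'I_4)%type) cell w ij = setT.
  apply/seteqP; split=> // z _.
  rewrite -bigcup_seq; exists (Defs.code w z.1, Defs.code w z.2) => //=.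
  by rewrite mem_index_enum.
rewrite -[in RHS]cellT integral_bigsetU_EFin//=.
- by move=> ij; exact: measurable_cell.
- exact: index_enum_uniq.
- by move=> [i j] [i' j'] _ _ /= [z [] [/= <- <-] [/= <- <-]].
- apply/measurable_EFinP; apply: measurable_funS (measurable_binorm_pdf r) => //.
Qed.

Lemma code_set_gt0 w (i : 'I_4) : 0 < w ->
  (0 < mu [set t | Defs.code w t = i])%E.
Proof.
move=> w0; rewrite code_setE//.
case: i => -[|[|[|[|//]]]] i4 /=; rewrite lebesgue_measure_itv/= ?lte_fin ?oppr_lt0 ?w0.
- by rewrite ltNyr/= lt0y.
- by rewrite opprK add0r lte_fin.
- by rewrite oppr0 addr0 lte_fin.
- by rewrite ltry/= lt0y.
Qed.

(** If the integral vanished, the density would be zero almost everywhere on the cell. As it is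
    positive everywhere, the cell would be a null set, yet it is a product of two intervals of
    positive length. *)
Lemma Pcell_gt0 r w ij : 0 < w -> -1 < r < 1 -> 0 < Pcell r w ij.
Proof.
move=> w0 r1; have mD := measurable_cell ij w0.
have mf : measurable_fun (cell w ij) (EFin \o binorm_pdf r).
  by apply/measurable_EFinP; apply: measurable_funS (measurable_binorm_pdf r).
have f0 z : 0 < binorm_pdf r z by exact: binorm_pdf_gt0.
rewrite -lte_fin EFin_Pcell// lt0e integral_ge0 ?andbT; last first.
  by move=> z _; rewrite lee_fin ltW.
apply/eqP => I0.
have : (\int[mu2]_(z in cell w ij) `|(EFin \o binorm_pdf r) z| = 0)%E.
  by rewrite -[RHS]I0; apply: eq_integral => z _; rewrite gee0_abs// lee_fin ltW.
move/(ae_eq_integral_abs _ mD mf) => [N [mN N0 DN]].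
have cN : cell w ij `<=` N.
  move=> z Dz; apply: DN => /= /(_ Dz) [] h.
  by have := f0 z; rewrite h ltxx.
have : (mu2 (cell w ij) <= mu2 N)%E by rewrite le_measure// inE.
rewrite leNgt => /negP; apply; rewrite [ltLHS]N0.
rewrite [ltRHS](_ : _ = mu [set t | Defs.code w t = ij.1] *
  mu [set t | Defs.code w t = ij.2])%E; last first.
  by apply: product_measure1E; exact: measurable_code_set.
by apply: mule_gt0; exact: code_set_gt0.
Qed.

Lemma Pcell_swap r w i j : 0 < w -> -1 < r < 1 ->
  Pcell r w (j, i) = Pcell r w (i, j).
Proof.
move=> w0 r1; apply: EFin_inj; rewrite !EFin_Pcell//.
rewrite integral_mkcond [RHS]integral_mkcond.
have mF ij : measurable_fun setT ((EFin \o binorm_pdf r) \_ (cell w ij)).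
  apply/(measurable_restrictT _ _).1; first exact: measurable_cell.
  by apply/measurable_EFinP; apply: measurable_funS (measurable_binorm_pdf r).
have F0 ij z : (0 <= ((EFin \o binorm_pdf r) \_ (cell w ij)) z)%E.
  by apply: erestrict_ge0 => // t _; rewrite lee_fin ltW// binorm_pdf_gt0.
(* Iterating the two sides in opposite orders exchanges the variables. *)
rewrite (fubini_tonelli1 _ (mF _) (F0 _)) (fubini_tonelli2 _ (mF _) (F0 _)).
apply: eq_integral => x _; apply: eq_integral => y _.
rewrite !patchE; congr (if _ then _ else _).
  by apply/idP/idP; rewrite !inE => -[].
exact: (congr1 EFin (binorm_pdf_swap r y x)).
Qed.

(* At the thresholds themselves the identity fails, the coding intervals being
   half-open. *)
Lemma code_oppr w t : 0 < w -> t \notin [:: - w; 0; w] ->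
  Defs.code w (- t) = rev_ord (Defs.code w t).
Proof.
move=> w0; rewrite !inE !negb_or => /and3P[tw t0 tw'].
have {}tw : t < - w \/ - w < t by apply/orP; rewrite -neq_lt.
have {}t0 : t < 0 \/ 0 < t by apply/orP; rewrite -neq_lt.
have {}tw' : t < w \/ w < t by apply/orP; rewrite -neq_lt.
apply/val_inj; rewrite /Defs.code /=.
case: tw => ?; case: t0 => ?; case: tw' => ?; try by exfalso; lra.
all: repeat case: leP => ?; first [by rewrite !inordK | by exfalso; lra].
Qed.

Lemma ge0_integralT_oppr (f : measurableTypeR R -> \bar R) :
  measurable_fun setT f -> (forall x, 0 <= f x)%E ->
  (\int[mu]_x f (- x)%R = \int[mu]_x f x)%E.
Proof.
move=> mf f0.
have mN : measurable_fun setT (-%R : measurableTypeR R -> measurableTypeR R) by [].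
transitivity (\int[pushforward mu (-%R : R -> measurableTypeR R)]_x f x)%E.
  by rewrite ge0_integral_pushforward//= => x _; exact: f0.
by apply: eq_measure_integral => A mA _; exact: lebesgue_measureN.
Qed.

(** The substitution [x -> - x] in the outer integral. The inner integrals agree only away from the
    thresholds [- w], [0], [w], which form a null set. *)
Lemma Pcell_reflect r w i j : 0 < w -> -1 < r < 1 ->
  Pcell r w (rev_ord i, j) = Pcell (- r) w (i, j).
Proof.
move=> w0 r1; have r1' : -1 < - r < 1 by rewrite ltrN2 ltrNl andbC.
apply: EFin_inj; rewrite !EFin_Pcell//.
rewrite integral_mkcond [RHS]integral_mkcond.
have mF s ij : measurable_fun setT ((EFin \o binorm_pdf s) \_ (cell w ij)).
  apply/(measurable_restrictT _ _).1; first exact: measurable_cell.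
  by apply/measurable_EFinP; apply: measurable_funS (measurable_binorm_pdf s).
have F0 s ij z : -1 < s < 1 -> (0 <= ((EFin \o binorm_pdf s) \_ (cell w ij)) z)%E.
  by move=> s1; apply: erestrict_ge0 => // t _; rewrite lee_fin ltW// binorm_pdf_gt0.
rewrite (fubini_tonelli1 _ (mF _ _)) => [|z]; last exact: F0.
rewrite (fubini_tonelli1 _ (mF _ _)) => [|z]; last exact: F0.
have mG s ij : -1 < s < 1 -> measurable_fun setT
    (fubini_F mu ((EFin \o binorm_pdf s) \_ (cell w ij))).
  by move=> s1; apply: measurable_fun_fubini_tonelli_F => // z; exact: F0.
have G0 s ij x : -1 < s < 1 ->
    (0 <= fubini_F mu ((EFin \o binorm_pdf s) \_ (cell w ij)) x)%E.
  by move=> s1; apply: integral_ge0 => y _; exact: F0.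
rewrite -ge0_integralT_oppr; [|exact: mG|by move=> x; exact: G0].
have mN : measurable_fun setT (-%R : measurableTypeR R -> measurableTypeR R) by [].
apply: ge0_ae_eq_integral => //.
- by apply: measurableT_comp => //; exact: mG.
- exact: mG.
- by move=> x _; exact: G0.
- by move=> x _; exact: G0.
have cw : countable [set` [:: - w; 0; w]] by exact: finite_set_countable.
exists [set` [:: - w; 0; w]]; split.
- by apply: countable_measurable; [move=> t; exact: measurable_set1|].
- exact: countable_lebesgue_measure0.
move=> x /= h; apply/negPn/negP => xw; apply: h => _.
apply: eq_integral => y _.
rewrite !patchE; congr (if _ then _ else _).
  by apply/idP/idP; rewrite !inE /cell/= code_oppr// => -[h ?]; split => //; [apply: rev_ord_inj|rewrite h].
exact: (congr1 EFin (binorm_pdf_oppr r x y)).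
Qed.

End Cells.

(** * Expectation over the sample *)

Section Multinomial.
Variable R : realType.

Lemma is_derive_fin_sum (I : finType) (h : I -> R -> R) (dh : I -> R) (r : R) :
  (forall i, is_derive r 1 (h i) (dh i)) ->
  is_derive r 1 (fun x => \sum_i h i x) (\sum_i dh i).
Proof.
move=> hd; rewrite (_ : (fun _ => _) = \sum_i h i); last first.
  by apply/funext => x; rewrite fct_sumE.
by elim/big_ind2 : _ => // [|] *; [exact: is_derive_cst|exact: is_deriveD].
Qed.

(** Linearity of expectation: the count is a sum of [k] indicators, each of expectation [p c]. *)
Lemma expected_count (C : finType) (p : C -> R) (k : nat) (c : C) :
  \sum_c p c = 1 ->
  \sum_(s : {ffun 'I_k -> C}) (\prod_(m < k) p (s m)) *
    (#|[pred m | s m == c]|)%:R = k%:R * p c.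
Proof.
move=> p1.
have -> : k%:R * p c = \sum_(m < k) p c by rewrite sumr_const card_ord mulr_natl.
have cE (s : {ffun 'I_k -> C}) :
    #|[pred m | s m == c]|%:R = \sum_m (s m == c)%:R :> R.
  by rewrite -sum1_card natr_sum big_mkcond; apply: eq_bigr => m _; rewrite inE; case: (s m == c).
under eq_bigr do rewrite cE mulr_sumr.
rewrite exchange_big; apply: eq_bigr => m _ /=.
(* The indicator is moved into the factor of draw [m], so the sum over samples factorises over the
   draws; every other factor sums to 1. *)
transitivity (\prod_(m' < k) \sum_c' (p c' * (if m' == m then (c' == c)%:R else 1))).
  rewrite bigA_distr_bigA; apply: eq_bigr => s _.
  rewrite big_split /=; congr (_ * _).
  rewrite (bigD1 m)//= eqxx big1 ?mulr1//.
  by move=> m' /negbTE ->.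
rewrite (bigD1 m)//= eqxx [X in _ * X]big1 ?mulr1.
  rewrite (bigD1 c)//= eqxx mulr1 big1 ?addr0//.
  by move=> c' /negbTE ->; rewrite mulr0.
by move=> m' /negbTE ->; under eq_bigr do rewrite mulr1.
Qed.

Implicit Types (r w : R) (ij : 'I_4 * 'I_4).

(* In [count_cell] the set is a classical one, not a [{set _}]. *)
Lemma count_cellE k (s : {ffun 'I_k -> 'I_4 * 'I_4}) ij :
  count_cell s ij = #|[pred m | s m == ij]|.
Proof. by apply: eq_card => m; apply/idP/idP; rewrite !inE. Qed.

Lemma near_oo (r : R) : -1 < r < 1 -> \forall t \near r, -1 < t < 1.
Proof.
by move=> /andP[r0 r1]; near=> t; apply/andP; split; near: t;
  [exact: lt_nbhsr|exact: lt_nbhsl].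
Unshelve. all: by end_near. Qed.

(** * Derivatives of the log-likelihood and their expectation *)

Lemma is_derive_loglik k (s : {ffun 'I_k -> 'I_4 * 'I_4}) w r :
  0 < w -> -1 < r < 1 -> is_derive r 1 (loglik s w)
  (\sum_ij (count_cell s ij)%:R * (Pcell1 r w ij / Pcell r w ij)).
Proof.
move=> w0 r1; apply: is_derive_fin_sum => ij.
have dP := is_derive_Pcell ij w0 r1.
have dl := @is_derive1_comp R (@ln R) (fun t => Pcell t w ij) r _ _
  (is_derive1_ln (Pcell_gt0 ij w0 r1)) dP.
by apply: is_derive_eq (is_deriveZ (count_cell s ij)%:R dl) _; rewrite mulrC.
Qed.

Lemma derive1n2_loglik k (s : {ffun 'I_k -> 'I_4 * 'I_4}) w r :
  0 < w -> -1 < r < 1 -> derive1n 2 (loglik s w) r =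
  \sum_ij (count_cell s ij)%:R *
    (Pcell2 r w ij / Pcell r w ij - (Pcell1 r w ij / Pcell r w ij) ^+ 2).
Proof.
move=> w0 r1; rewrite derive1nS derive1n1 derive1E.
have : is_derive r 1 (fun t => \sum_ij (count_cell s ij)%:R *
    (Pcell1 t w ij / Pcell t w ij)) (\sum_ij (count_cell s ij)%:R *
    (Pcell2 r w ij / Pcell r w ij - (Pcell1 r w ij / Pcell r w ij) ^+ 2)).
  apply: is_derive_fin_sum => ij.
  have P0 : Pcell r w ij != 0 by rewrite gt_eqF// Pcell_gt0.
  have dV := @is_deriveV R (fun t => Pcell t w ij) r _ _ P0 (is_derive_Pcell ij w0 r1).
  have dM := is_deriveM (is_derive_Pcell1 ij w0 r1) dV.
  apply: is_derive_eq (is_deriveZ (count_cell s ij)%:R dM) _.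
  by rewrite /GRing.scale/=; field.
move=> dL.
(* Differentiating a second time needs the formula for the first derivative on a neighbourhood of
   [r]. *)
have nL : \forall t \near r, \sum_ij (count_cell s ij)%:R *
    (Pcell1 t w ij / Pcell t w ij) = derive1 (loglik s w) t.
  near=> t; rewrite derive1E; apply/esym.
  apply: (@derive_val _ _ _ _ _ _ _ (is_derive_loglik s w0 _)).
  by near: t; exact: near_oo.
exact: (@derive_val _ _ _ _ _ _ _ (near_eq_is_derive nL dL)).
Unshelve. all: by end_near. Qed.

(** [sum_Pcell] holds throughout the open interval, so it may be differentiated twice. *)
Lemma sum_Pcell2 w r : 0 < w -> -1 < r < 1 -> \sum_ij Pcell2 r w ij = 0.
Proof.
move=> w0 r1.
have sum1 t : -1 < t < 1 -> \sum_ij Pcell1 t w ij = 0.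
  move=> t1; have d := is_derive_fin_sum (fun ij => is_derive_Pcell ij w0 t1).
  have n1 : \forall u \near t, \sum_ij Pcell u w ij = cst 1 u.
    by near=> u; rewrite sum_Pcell//; near: u; exact: near_oo.
  have := near_eq_is_derive n1 d => -[_ <-]; exact: derive_cst.
have d := is_derive_fin_sum (fun ij => is_derive_Pcell1 ij w0 r1).
have n1 : \forall u \near r, \sum_ij Pcell1 u w ij = cst 0 u.
  by near=> u; rewrite sum1//; near: u; exact: near_oo.
have := near_eq_is_derive n1 d => -[_ <-]; exact: derive_cst.
Unshelve. all: by end_near. Qed.

Lemma fisher_info_cells k w r : 0 < w -> -1 < r < 1 ->
  fisher_info k r w = k%:R * \sum_ij Pcell1 r w ij ^+ 2 / Pcell r w ij.
Proof.
move=> w0 r1; rewrite /fisher_info.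
pose D ij := Pcell2 r w ij / Pcell r w ij - (Pcell1 r w ij / Pcell r w ij) ^+ 2.
transitivity (- \sum_ij (k%:R * Pcell r w ij) * D ij).
  congr (- _).
  under eq_bigr => s _.
    rewrite (derive1n2_loglik s w0 r1) mulr_sumr.
    under eq_bigr do rewrite mulrA.
    over.
  rewrite exchange_big; apply: eq_bigr => ij _; rewrite -mulr_suml.
  under eq_bigr do rewrite count_cellE.
  by rewrite (expected_count _ _ (sum_Pcell w0 r1)).
(* Cell by cell, [- P * D = P'^2 / P - P'']. *)
transitivity (k%:R * (\sum_ij Pcell1 r w ij ^+ 2 / Pcell r w ij
    - \sum_ij Pcell2 r w ij)); last by rewrite sum_Pcell2// subr0.
rewrite -sumrN -sumrB mulr_sumr.
apply: eq_bigr => ij _; rewrite /D.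
have P0 : Pcell r w ij != 0 by rewrite gt_eqF// Pcell_gt0.
by field.
Qed.

Lemma Pcell1_swap r w i j : 0 < w -> -1 < r < 1 ->
  Pcell1 r w (j, i) = Pcell1 r w (i, j).
Proof.
move=> w0 r1; have d := is_derive_Pcell (j, i) w0 r1.
have n1 : \forall u \near r, Pcell u w (j, i) = Pcell u w (i, j).
  by near=> u; apply: Pcell_swap => //; near: u; exact: near_oo.
have [_ <-] := near_eq_is_derive n1 d.
by have [_ <-] := is_derive_Pcell (i, j) w0 r1.
Unshelve. all: by end_near. Qed.

(** The sign comes from the chain rule through [u -> - u]; it disappears once the derivative is
    squared. *)
Lemma Pcell1_reflect r w i j : 0 < w -> -1 < r < 1 ->
  Pcell1 r w (rev_ord i, j) = - Pcell1 (- r) w (i, j).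
Proof.
move=> w0 r1; have r1' : -1 < - r < 1 by rewrite ltrN2 ltrNl andbC.
have d := is_derive_Pcell (rev_ord i, j) w0 r1.
have n1 : \forall u \near r, Pcell u w (rev_ord i, j) = Pcell (- u) w (i, j).
  by near=> u; apply: Pcell_reflect => //; near: u; exact: near_oo.
have [_ <-] := near_eq_is_derive n1 d.
have := @is_derive1_comp R (fun t => Pcell t w (i, j)) -%R r _ _
  (is_derive_Pcell (i, j) w0 r1') (is_deriveNid r 1).
by case=> _ -> ; rewrite mulrN1.
Unshelve. all: by end_near. Qed.

(** [T] and [T'] stand for the terms at [rho] and [- rho]. Reversing both indices fixes [T], so the
    two quadrants of equal signs contribute the same sum of [T]; one reversal turns each of the
    other two into that sum for [T']. *)
Lemma sum_symmetric_cells (T T' : 'I_4 -> 'I_4 -> R) :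
  (forall i j, T j i = T i j) -> (forall i j, T' j i = T' i j) ->
  (forall i j, T (rev_ord i) j = T' i j) ->
  \sum_ij T ij.1 ij.2 =
  2 * (T (inord 2) (inord 2) + 2 * T (inord 3) (inord 2) + T (inord 3) (inord 3)
    + T' (inord 2) (inord 2) + 2 * T' (inord 3) (inord 2)
    + T' (inord 3) (inord 3)).
Proof.
move=> Tswap T'swap Trev; rewrite -(pair_bigA _ T).
set i2 := inord 2; set i3 := inord 3.
(* The codes 0 and 1 are written as reversals of 3 and 2 to let the symmetry hypotheses rewrite. *)
have sum4 (F : 'I_4 -> R) :
    \sum_i F i = F (rev_ord i3) + F (rev_ord i2) + F i2 + F i3.
  rewrite !big_ord_recl big_ord0 addr0 !addrA.
  by do ![congr (_ + _)]; congr F; apply/val_inj; rewrite /= !inordK.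
have Trevr i j : T i (rev_ord j) = T' j i by rewrite Tswap Trev.
have Trev2 i j : T (rev_ord i) (rev_ord j) = T i j.
  by rewrite Trevr T'swap -Trev rev_ordK.
rewrite !sum4 !Trev2 !Trev !Trevr (Tswap i3 i2) (T'swap i3 i2); ring.
Qed.

End Multinomial.

Theorem theorem1 (R : realType) (k : nat) (w rho : R) :
  0 < w -> -1 < rho < 1 ->
  fisher_info k rho w = 2 * k%:R * A_term rho w.
Proof.
move=> w0 r1; have r1' : -1 < - rho < 1 by rewrite ltrN2 ltrNl andbC.
rewrite (fisher_info_cells _ w0 r1) /A_term.
(* [P22], [P23] and [P33] unfold to instances of [Pcell], so this rule covers all six
   derivatives. *)
have dPE ij r : -1 < r < 1 -> dP (fun s w => Pcell s w ij) r w = Pcell1 r w ij.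
  by move=> h; rewrite /dP derive1E; have [_ ->] := is_derive_Pcell ij w0 h.
rewrite !(dPE _ _ r1) !(dPE _ _ r1') (mulrC 2) -mulrA; congr (_ * _).
pose T r (i j : 'I_4) := Pcell1 r w (i, j) ^+ 2 / Pcell r w (i, j).
have Tswap r (r1'' : -1 < r < 1) i j : T r j i = T r i j.
  by rewrite /T (Pcell_swap _ _ w0 r1'') (Pcell1_swap _ _ w0 r1'').
have Trev i j : T rho (rev_ord i) j = T (- rho) i j.
  by rewrite /T (Pcell_reflect _ _ w0 r1) (Pcell1_reflect _ _ w0 r1) sqrrN.
rewrite -[RHS](sum_symmetric_cells (Tswap _ r1) (Tswap _ r1') Trev).
by apply: eq_bigr => -[i j] _.
Qed.
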